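(* Let $G$ be a simple algebraic group over $\mathbb C$ with Lie algebra $\mathfrak g$, $N\subset G$ a unipotent subgroup, $\mathfrak n=\mathrm{Lie}(N)$, $X=G/N$, $\pi:G\to X$ the projection, and $(,)$ a symmetric ad-invariant bilinear form on $\mathfrak g$ with dual level $(,)^o=-(,)_{(K)}-(,)$, where $(,)_{(K)}$ is the Killing form of $\mathfrak g$. Put $\mathcal D^{ch}_{X;(,)}=H^0_{BRST}(L\mathfrak n;\pi_*\mathcal D^{ch}_{G;(,)})$. Then the dual embedding $j_R:\mathcal V_{\mathfrak g;(,)^o}\to\mathcal D^{ch}_{G;(,)}$ induces (by taking $v$ to the BRST cohomology class of $1\otimes j_R(v)$) a canonical morphism of vertex algebras $$i^o_{(,)}:\ \mathcal V_{\mathfrak g;(,)^o}\to\mathcal D^{ch}_{X;(,)}$$ (that is, a morphism to the vertex algebra of global sections of $\mathcal D^{ch}_{X;(,)}$).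
   Context: Everything is over $\mathbb{C}$; algebraic groups are connected. A $\mathbb{Z}_{\ge 0}$-graded vertex algebra $V=\bigoplus_{i\ge 0}V_i$ has vacuum $\mathbf 1\in V_0$, translation operator $\partial$ of degree $1$, and products satisfying $x_{(n)}y\in V_{i+j-n-1}$ for $x\in V_i,\ y\in V_j$; the grading is called weight. $\mathcal V_{\mathfrak g;(,)}$ is the universal affine vertex algebra at level $(,)$: generated by fields $\tau(z)$, $\tau\in\mathfrak g$, of weight $1$, subject only to $\tau_{(1)}\tau'=(\tau,\tau')\mathbf 1$, $\tau_{(0)}\tau'=[\tau,\tau']$, $\tau_{(n)}\tau'=0$ for $n\ge2$. Let $i_L,i_R$ be the two commuting Lie algebra embeddings of $\mathfrak g$ into vector fields on $G$: $(i_L(x)f)(g)=\frac{d}{dt}\big|_{t=0}f(g\exp(tx))$, $(i_R(x)f)(g)=\frac{d}{dt}\big|_{t=0}f(\exp(-tx)g)$. $\mathcal D^{ch}_{G;(,)}$ is the sheaf of graded vertex algebras on $G$ whose sections over an affine open $U\subset G$ form the graded vertex algebra generated by $\mathcal O(U)$ in weight $0$ and $\mathfrak g$ in weight $1$ (embedded linearly), subject only to: $1\in\mathcal O(U)$ is the vacuum; $a_{(-1)}b=ab$, $a_{(n)}b=0$ for $n\ge0$; $\tau_{(0)}a=i_L(\tau)(a)$, $\tau_{(n)}a=0$ for $n\geq1$; $\tau_{(1)}\tau'=(\tau,\tau')\mathbf 1$, $\tau_{(0)}\tau'=[\tau,\tau']$, $\tau_{(n)}\tau'=0$ for $n\ge2$.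 Its weight $1$ component is identified with $\Theta_G\oplus\Omega^1_G$ by $(a\,i_L(\tau),b\,dc)\mapsto a_{(-1)}\tau+b_{(-1)}\partial c$. Dual embedding: $j_R:\mathcal V_{\mathfrak g;(,)^o}\hookrightarrow\Gamma(G;\mathcal D^{ch}_{G;(,)})$ is the (existing) embedding of vertex algebras whose restriction to $\mathfrak g$ is the unique linear map $\mathfrak g\to\Gamma(G;\mathcal D^{ch}_{G;(,)})_1$ which composes with the projection to vector fields to give $i_R$ and satisfies $\tau_{(n)}j_R(\tau')=0$ for all generators $\tau\in\mathfrak g$, all $\tau'\in\mathfrak g$ and $n\ge0$. BRST cohomology: the form $(,)$ vanishes on $\mathfrak n$, and the Killing form of $\mathfrak n$ is zero. Let $\{a_i\}$ be a basis of $\mathfrak n$ with $[a_i,a_j]=\sum_p c^{ij}_pa_p$. $C_{BRST}(L\mathfrak n)$ is the graded vertex superalgebra generated by odd fields $\phi_i(z)$ of weight $1$ and odd fields $\phi_i^*(z)$ of weight $0$ whose only nontrivial OPE is $\phi_i(z)\phi^*_j(w)\sim\delta_{ij}/(z-w)$. Put $C_{BRST}(L\mathfrak n;\pi_*\mathcal D^{ch}_{G;(,)})=C_{BRST}(L\mathfrak n)\otimes\pi_*\mathcal D^{ch}_{G;(,)}$, a sheaf of vertex superalgebras on $X$, graded by fermionic charge: $\phi_i$ has charge $-1$, $\phi^*_i$ charge $1$, $\pi_*\mathcal D^{ch}_{G;(,)}$ charge $0$. Let $D=\sum_i\phi_i^*\otimes a_i-\frac12\sum_{i,j,p}c^{ij}_p\,\phi_p\phi_i^*\phi_j^*\otimes1$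 (normally ordered products; $a_i\in\mathfrak n\subset\mathfrak g$ viewed as weight $1$ generators). The operator $d=D_{(0)}$ satisfies $d^2=0$ and raises the charge by $1$; $H^i_{BRST}(L\mathfrak n;\pi_*\mathcal D^{ch}_{G;(,)})$ is the cohomology sheaf of $d$ in charge $i$. The total cohomology is a sheaf of graded vertex superalgebras. *)

(* Defs.v *)
From HB Require Import structures.
From mathcomp Require Import all_boot all_order all_algebra.
From mathcomp Require Import all_classical all_reals topology_structure connected normed_module.
From mathcomp Require Import complex ring.

Set Implicit Arguments.
Unset Strict Implicit.
Unset Printing Implicit Defensive.

Import Order.TTheory GRing.Theory Num.Theory.
Import numFieldNormedType.Exports.
Local Open Scope classical_set_scope.
Local Open Scope ring_scope.

(** * Classical affine varieties and algebraic groups *)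

Section Varieties.
Variables (K : numClosedFieldType) (T : Type).
Implicit Types (U : set T) (f g e : T -> K) (A : set (T -> K)).

(* A function on U is encoded as a function on the ambient space that vanishes
   off U. *)
Definition mask U f : T -> K := fun x => if `[<U x>] then f x else 0.

Definition unital_subalg e A :=
  [/\ forall c : K, A (c *: e),
      forall f g, A f -> A g -> A (f + g) &
      forall f g, A f -> A g -> A (f * g)].

Definition fin_gen e A := exists (n : nat) (x : 'I_n -> T -> K),
  (forall i, A (x i)) /\
  (forall A', unital_subalg e A' -> (forall i, A' (x i)) -> A `<=` A').

Definition alg_char e A (chi : (T -> K) -> K) :=
  [/\ chi e = 1,
      forall c f g, A f -> A g -> chi (c *: f + g) = c * chi f + chi g &
      forall f g, A f -> A g -> chi (f * g) = chi f * chi g].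

(* U with the algebra A of functions is an affine variety: A is finitely
   generated and the points of U are the characters of A. *)
Definition affine_variety U A :=
  [/\ forall f, A f -> forall x, ~ U x -> f x = 0,
      unital_subalg (mask U (cst 1)) A,
      fin_gen (mask U (cst 1)) A &
      forall chi, alg_char (mask U (cst 1)) A chi ->
        exists! x, U x /\ forall f, A f -> chi f = f x].
End Varieties.

Record alg_group (K : numClosedFieldType) := AlgGroup {
  gsort :> groupType;
  reg : set (gsort -> K);
  reg_affine : affine_variety setT reg;
  (* multiplication and inverse are morphisms; O(G x G) = O(G) (x) O(G) *)
  reg_comul : forall f, reg f -> exists (n : nat) (u v : 'I_n -> gsort -> K),
    (forall i, reg (u i) /\ reg (v i)) /\
    forall g h, f (g * h)%g = \sum_(i < n) u i g * v i h;
  reg_inv : forall f, reg f -> reg (fun g => f (g^-1)%g)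
}.

Definition zariski (K : numClosedFieldType) (G : alg_group K) : Type := G.

Identity Coercion fun_of_set : set >-> Funclass.

Record opens (T : topologicalType) := Opens {
  oset :> set T;
  oset_open : open oset
}.

Section Group.
Variables (K : numClosedFieldType) (G : alg_group K).
Local Notation reg := (@reg K G).
Implicit Types (f a b : G -> K) (g h : G).

Lemma fmulE f f' x : (f * f') x = f x * f' x. Proof. by []. Qed.
Lemma faddE f f' x : (f + f') x = f x + f' x. Proof. by []. Qed.
Lemma fscaleE (c : K) f x : (c *: f) x = c * f x. Proof. by []. Qed.
Definition fE := (fmulE, faddE, fscaleE).

Lemma mask_setT f : mask setT f = f.
Proof. by apply/funext => x; rewrite /mask asboolT. Qed.

Lemma reg_cst (c : K) : reg (cst c).
Proof.
have [_ [H _ _] _ _] := reg_affine G.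
have -> : cst c = c *: mask setT (cst 1) :> (G -> K).
  by apply/funext => x; rewrite mask_setT; exact: (esym (mulr1 c)).
exact: H.
Qed.

Lemma reg_add a b : reg a -> reg b -> reg (a + b).
Proof. by have [_ [_ H _] _ _] := reg_affine G; apply: H. Qed.

Lemma reg_mul a b : reg a -> reg b -> reg (a * b).
Proof. by have [_ [_ _ H] _ _] := reg_affine G; apply: H. Qed.

Lemma reg_scale (c : K) a : reg a -> reg (c *: a).
Proof.
move=> ra; have -> : c *: a = cst c * a by apply/funext.
by apply: reg_mul => //; exact: reg_cst.
Qed.

Lemma reg_sum n (u : 'I_n -> G -> K) : (forall i, reg (u i)) ->
  reg (\sum_(i < n) u i).
Proof.
by move=> H; apply: big_ind => //; [exact: (reg_cst 0)|exact: reg_add].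
Qed.

(** ** Zariski topology *)

Definition zariski_open (U : set (zariski G)) := forall x : G, U x ->
  exists b, [/\ reg b, b x != 0 & forall y, b y != 0 -> U y].

HB.instance Definition _ := gen_eqMixin (zariski G).
HB.instance Definition _ := gen_choiceMixin (zariski G).

Fact zariski_openT : zariski_open setT.
Proof.
by move=> x _; exists (cst 1); split => //; [exact: reg_cst|rewrite oner_neq0].
Qed.

Fact zariski_openI U V : zariski_open U -> zariski_open V -> zariski_open (U `&` V).
Proof.
move=> oU oV x [/oU[b [rb bx bU]] /oV[c [rc cx cV]]].
exists (b * c); split; first exact: reg_mul.
  by rewrite mulf_neq0.
by move=> y; rewrite fE mulf_eq0 negb_or => /andP[/bU ? /cV].
Qed.

Fact zariski_open_bigU (I : Type) (F : I -> set (zariski G)) :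
  (forall i, zariski_open (F i)) -> zariski_open (\bigcup_i F i).
Proof.
move=> oF x [i _ /oF[b [rb bx bF]]]; exists b; split => // y /bF Fy.
by exists i.
Qed.

HB.instance Definition _ := isOpenTopological.Build (zariski G)
  zariski_openT zariski_openI zariski_open_bigU.

(** ** Regular functions *)

(* The principal opens are a basis: f is regular at x iff it is a fraction a/b
   of elements of O(G) on some principal open {b <> 0} containing x. *)
Definition regular_at f (x : G) := exists a b,
  [/\ reg a, reg b, b x != 0 & forall y, b y != 0 -> f y = a y / b y].

Lemma regular_at_reg a x : reg a -> regular_at a x.
Proof.
move=> ra; exists a, (cst 1); split => //; first exact: reg_cst.
  by rewrite oner_neq0.
by move=> y _; rewrite divr1.
Qed.

Lemma regular_at_lin (c : K) f1 f2 x : regular_at f1 x -> regular_at f2 x ->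
  regular_at (c *: f1 + f2) x.
Proof.
move=> [a1 [b1 [ra1 rb1 n1 e1]]] [a2 [b2 [ra2 rb2 n2 e2]]].
exists (c *: (a1 * b2) + a2 * b1), (b1 * b2); split.
- by apply: reg_add; [apply: reg_scale|]; apply: reg_mul.
- exact: reg_mul.
- by rewrite fE mulf_neq0.
- move=> y; rewrite !fE mulf_eq0 negb_or => /andP[h1 h2].
  rewrite e1 // e2 //.
  by field; rewrite h1 h2.
Qed.

Lemma regular_at_mul f1 f2 x : regular_at f1 x -> regular_at f2 x ->
  regular_at (f1 * f2) x.
Proof.
move=> [a1 [b1 [ra1 rb1 n1 e1]]] [a2 [b2 [ra2 rb2 n2 e2]]].
exists (a1 * a2), (b1 * b2); split; try exact: reg_mul.
- by rewrite fE mulf_neq0.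
- move=> y; rewrite !fE mulf_eq0 negb_or => /andP[h1 h2].
  rewrite e1 // e2 //.
  by field; rewrite h1 h2.
Qed.

Lemma regular_at_near f1 f2 b x : reg b -> b x != 0 ->
  (forall y, b y != 0 -> f1 y = f2 y) -> regular_at f1 x -> regular_at f2 x.
Proof.
move=> rb nb e12 [a1 [b1 [ra1 rb1 n1 e1]]].
exists (a1 * b), (b1 * b); split; try exact: reg_mul.
- by rewrite fE mulf_neq0.
- move=> y; rewrite !fE mulf_eq0 negb_or => /andP[h1 h].
  rewrite -e12 // e1 //.
  by field; rewrite h1 h.
Qed.

Lemma reg_ltrans a g : reg a -> reg (fun h => a (g * h)%g).
Proof.
move=> /reg_comul[n [u [v [ruv e]]]].
have -> : (fun h => a (g * h)%g) = \sum_(i < n) u i g *: v i.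
  by apply/funext => h; rewrite e fct_sumE.
by apply: reg_sum => i; apply: reg_scale; have [] := ruv i.
Qed.

Lemma regular_at_ltrans f g : regular_at f g ->
  regular_at (fun h => f (g * h)%g) 1%g.
Proof.
move=> [a [b [ra rb n e]]].
exists (fun h => a (g * h)%g), (fun h => b (g * h)%g); split.
- exact: reg_ltrans.
- exact: reg_ltrans.
- by rewrite mulg1.
- by move=> y; apply: e.
Qed.

Section StructureSheaf.
Variable U : opens (zariski G).

Definition regular_on : {pred G -> K} := mem [set f : G -> K |
  (forall x, ~ U x -> f x = 0) /\ (forall x, U x -> regular_at f x)].

Fact regular_on_submod : submod_closed regular_on.
Proof.
split.
  rewrite inE; split => // x _; exact: (regular_at_reg _ (reg_cst 0)).
move=> c f1 f2; rewrite !inE => -[z1 r1] [z2 r2]; split.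
  by move=> x Ux; rewrite !fE z1 // z2 // mulr0 addr0.
by move=> x Ux; apply: regular_at_lin; [exact: r1|exact: r2].
Qed.

HB.instance Definition _ := GRing.isSubmodClosed.Build K (G -> K) regular_on
  regular_on_submod.

(* O(U) *)
Record regfun := RegFun {
  regfun_val :> G -> K;
  regfun_valP : regfun_val \in regular_on
}.

HB.instance Definition _ := [isSub of regfun for regfun_val].
HB.instance Definition _ := [Choice of regfun by <:].
HB.instance Definition _ := [SubChoice_isSubLmodule of regfun by <:].

Lemma regfun_regular (f : regfun) x : U x -> regular_at f x.
Proof. by case: f => f /=; rewrite inE => -[_ H]; apply: H. Qed.

Fact mask_regular f : (forall x, U x -> regular_at f x) ->
  mask U f \in regular_on.
Proof.
move=> H; rewrite inE; split => x Ux; first by rewrite /mask asboolF.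
have oU : zariski_open U := oset_open U.
have [b [rb bx bU]] := oU x Ux.
apply: (regular_at_near rb bx _ (H x Ux)) => y /bU Uy.
by rewrite /mask asboolT.
Qed.

Definition regfun_mask f (H : forall x, U x -> regular_at f x) : regfun :=
  RegFun (mask_regular H).

Definition regfun1 : regfun :=
  regfun_mask (fun x _ => regular_at_reg x (reg_cst 1)).

Definition regfun_mul (f1 f2 : regfun) : regfun := regfun_mask (fun x Ux =>
  regular_at_mul (regfun_regular f1 Ux) (regfun_regular f2 Ux)).

Definition affine_open := affine_variety U [set` regular_on].
End StructureSheaf.

(** ** The Lie algebra *)

(* Tangent vectors at 1: K-linear derivations of the local ring at 1. They are
   extended by 0 to functions that are not regular at 1, so that Leibniz equality
   is equality of derivations. *)
Definition tangent : {pred (G -> K) -> K} := mem [set x : (G -> K) -> K |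
  [/\ forall c f1 f2, regular_at f1 1%g -> regular_at f2 1%g ->
        x (c *: f1 + f2) = c * x f1 + x f2,
      forall f1 f2, regular_at f1 1%g -> regular_at f2 1%g ->
        x (f1 * f2) = f1 1%g * x f2 + x f1 * f2 1%g &
      forall f, ~ regular_at f 1%g -> x f = 0]].

Fact tangent_submod : submod_closed tangent.
Proof.
split.
  rewrite inE; split=> [c f1 f2 _ _|f1 f2 _ _|//].
    by rewrite -[LHS](addr0 0) -{1}(mulr0 c).
  by rewrite -[LHS](addr0 0) -{1}(mulr0 (f1 1%g)) -{2}(mul0r (f2 1%g)).
move=> c x y; rewrite !inE => -[lx dx zx] [ly dy zy].
have E f : (c *: x + y) f = c * x f + y f by [].
split.
- by move=> k f1 f2 r1 r2; rewrite !E lx // ly //; ring.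
- by move=> f1 f2 r1 r2; rewrite !E dx // dy //; ring.
- by move=> f nf; rewrite E zx // zy // mulr0 addr0.
Qed.

HB.instance Definition _ := GRing.isSubmodClosed.Build K ((G -> K) -> K) tangent
  tangent_submod.

Record lie := Lie {
  lie_val :> (G -> K) -> K;
  lie_valP : lie_val \in tangent
}.

HB.instance Definition _ := [isSub of lie for lie_val].
HB.instance Definition _ := [Choice of lie by <:].
HB.instance Definition _ := [SubChoice_isSubLmodule of lie by <:].

Implicit Types x y : lie.

Lemma lie_lin x c f1 f2 : regular_at f1 1%g -> regular_at f2 1%g ->
  x (c *: f1 + f2) = c * x f1 + x f2.
Proof. by case: x => x /=; rewrite inE => -[H _ _]; apply: H. Qed.

Lemma lie_leibniz x f1 f2 : regular_at f1 1%g -> regular_at f2 1%g ->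
  x (f1 * f2) = f1 1%g * x f2 + x f1 * f2 1%g.
Proof. by case: x => x /=; rewrite inE => -[_ H _]; apply: H. Qed.

Lemma lie0 x : x 0 = 0.
Proof.
have r : regular_at 0 1%g by exact: (regular_at_reg _ (reg_cst 0)).
have := lie_lin x (-1) r r; rewrite scaler0 addr0 => ->.
by rewrite mulN1r addNr.
Qed.

Lemma lie_near x f1 f2 b : reg b -> b 1%g != 0 ->
  (forall h, b h != 0 -> f1 h = f2 h) ->
  regular_at f1 1%g -> x f1 = x f2.
Proof.
move=> rb nb e12 r1; have r2 := regular_at_near rb nb e12 r1.
have rb1 := regular_at_reg 1%g rb.
have e : b * f1 = b * f2.
  apply/funext => h; rewrite !fE.
  by have [->|/e12 ->//] := eqVneq (b h) 0; rewrite !mul0r.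
have := lie_leibniz x rb1 r1; rewrite e lie_leibniz // e12 // => /addIr.
by move/(mulfI nb) => ->.
Qed.

(* i_L(x) f (g) = d/dt f (g exp(tx)) at t = 0, the derivative of h |-> f (g h)
   along the tangent vector x; likewise for i_R *)
Definition lder x f : G -> K := fun g => x (fun h => f (g * h)%g).
Definition rder x f : G -> K := fun g => x (fun h => f (h^-1 * g)%g).

Lemma lie_sum x n (c : 'I_n -> K) (v : 'I_n -> G -> K) :
  (forall i, reg (v i)) ->
  x (\sum_(i < n) c i *: v i) = \sum_(i < n) c i * x (v i).
Proof.
move=> rv; elim: n c v rv => [|n IH] c v rv; first by rewrite !big_ord0 lie0.
rewrite !big_ord_recl lie_lin ?IH //; apply: regular_at_reg => //.
by apply: reg_sum => i; apply: reg_scale.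
Qed.

Lemma lder_reg x a : reg a -> reg (lder x a).
Proof.
move=> /reg_comul[n [u [v [ruv e]]]].
have -> : lder x a = \sum_(i < n) x (v i) *: u i.
  apply/funext => g; rewrite /lder.
  have -> : (fun h => a (g * h)%g) = \sum_(i < n) u i g *: v i.
    by apply/funext => h; rewrite e fct_sumE.
  rewrite lie_sum ?fct_sumE; last by move=> i; have [] := ruv i.
  by apply: eq_bigr => i _; rewrite mulrC.
by apply: reg_sum => i; apply: reg_scale; have [] := ruv i.
Qed.

Lemma lder_frac x f a b g : reg a -> reg b -> b g != 0 ->
  (forall h, b h != 0 -> f h = a h / b h) ->
  lder x f g = (b g * lder x a g - a g * lder x b g) / (b g * b g).
Proof.
move=> ra rb nb e.
have rf : regular_at f g by exists a, b.
rewrite /lder; set F := fun h => f (g * h)%g.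
set A := fun h => a (g * h)%g; set B := fun h => b (g * h)%g.
have rF : regular_at F 1%g by exact: regular_at_ltrans.
have rA : regular_at A 1%g by apply/regular_at_reg/reg_ltrans.
have rB' : reg B by exact: reg_ltrans.
have rB : regular_at B 1%g by exact: regular_at_reg.
have B1 : B 1%g = b g by rewrite /B mulg1.
have A1 : A 1%g = a g by rewrite /A mulg1.
have F1 : F 1%g = a g / b g by rewrite /F mulg1 e.
have E : x (F * B) = x A.
  apply: (@lie_near x _ _ B) => //; first by rewrite B1.
    by move=> h nB; rewrite fE /F /A e // divfK.
  exact: regular_at_mul.
have := lie_leibniz x rF rB; rewrite E F1 B1 => ->.
by field.
Qed.

Lemma lder_regular_at x f g : regular_at f g -> regular_at (lder x f) g.
Proof.
move=> [a [b [ra rb nb e]]].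
exists (b * lder x a + (-1) *: (a * lder x b)), (b * b); split.
- apply: reg_add; [|apply: reg_scale]; apply: reg_mul => //; exact: lder_reg.
- exact: reg_mul.
- by rewrite fE mulf_neq0.
- move=> y; rewrite !fE mulf_eq0 orbb => nby.
  rewrite (lder_frac x ra rb nby e); congr (_ / _).
  by ring.
Qed.

Definition vfL (U : opens (zariski G)) x (f : regfun U) : regfun U :=
  regfun_mask (fun g Ug => lder_regular_at x (regfun_regular f Ug)).

Lemma regular_at_nbhs f g : regular_at f g ->
  exists b, [/\ reg b, b g != 0 & forall h, b h != 0 -> regular_at f h].
Proof. by move=> [a [b [ra rb nb e]]]; exists b; split=> // y ny; exists a, b. Qed.

Lemma lder_lin x c f1 f2 g : regular_at f1 g -> regular_at f2 g ->
  lder x (c *: f1 + f2) g = c * lder x f1 g + lder x f2 g.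
Proof.
by move=> r1 r2; rewrite /lder -lie_lin //; apply: regular_at_ltrans.
Qed.

Lemma lder_leibniz x f1 f2 g : regular_at f1 g -> regular_at f2 g ->
  lder x (f1 * f2) g = f1 g * lder x f2 g + lder x f1 g * f2 g.
Proof.
move=> r1 r2; rewrite /lder.
have -> : (fun h => (f1 * f2) (g * h)%g) =
  (fun h => f1 (g * h)%g) * (fun h => f2 (g * h)%g) by [].
by rewrite lie_leibniz ?mulg1 //; apply: regular_at_ltrans.
Qed.

Lemma lder1 x f : lder x f 1%g = x f.
Proof. by rewrite /lder; congr (lie_val x _); apply/funext => h; rewrite mul1g. Qed.

(* [x, y] is the value at 1 of the commutator of left invariant fields. *)
Definition lie_bracket_val x y : (G -> K) -> K := fun f =>
  if `[<regular_at f 1%g>] then x (lder y f) - y (lder x f) else 0.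

Lemma lie_lder_lin x y c f1 f2 : regular_at f1 1%g -> regular_at f2 1%g ->
  x (lder y (c *: f1 + f2)) = c * x (lder y f1) + x (lder y f2).
Proof.
move=> r1 r2; rewrite -lie_lin; try exact: lder_regular_at.
have [b1 [rb1 nb1 H1]] := regular_at_nbhs r1.
have [b2 [rb2 nb2 H2]] := regular_at_nbhs r2.
apply: (@lie_near x _ _ (b1 * b2)).
- exact: reg_mul.
- by rewrite fE mulf_neq0.
- move=> g; rewrite !fE mulf_eq0 negb_or.
  by move=> /andP[/H1 ? /H2 ?]; rewrite lder_lin.
- exact/lder_regular_at/regular_at_lin.
Qed.

Lemma lie_lder_leibniz x y f1 f2 : regular_at f1 1%g -> regular_at f2 1%g ->
  x (lder y (f1 * f2)) = f1 1%g * x (lder y f2) + x f1 * y f2 +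
    (y f1 * x f2 + x (lder y f1) * f2 1%g).
Proof.
move=> r1 r2.
have d1 := lder_regular_at y r1; have d2 := lder_regular_at y r2.
have [b1 [rb1 nb1 H1]] := regular_at_nbhs r1.
have [b2 [rb2 nb2 H2]] := regular_at_nbhs r2.
transitivity (x (f1 * lder y f2 + lder y f1 * f2)).
  apply: (@lie_near x _ _ (b1 * b2)).
  - exact: reg_mul.
  - by rewrite fE mulf_neq0.
  - move=> g; rewrite !fE mulf_eq0 negb_or.
    by move=> /andP[/H1 ? /H2 ?]; rewrite lder_leibniz.
  - exact/lder_regular_at/regular_at_mul.
rewrite -[f1 * _]scale1r lie_lin; try exact: regular_at_mul.
by rewrite mul1r !lie_leibniz // !lder1.
Qed.

Fact lie_bracket_tangent x y : lie_bracket_val x y \in tangent.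
Proof.
rewrite inE; split.
- move=> c f1 f2 r1 r2; rewrite /lie_bracket_val !asboolT //.
    by rewrite !lie_lder_lin //; ring.
  exact: regular_at_lin.
- move=> f1 f2 r1 r2; rewrite /lie_bracket_val !asboolT //.
    by rewrite !lie_lder_leibniz //; ring.
  exact: regular_at_mul.
- by move=> f nf; rewrite /lie_bracket_val asboolF.
Qed.

Definition lie_bracket x y : lie := Lie (lie_bracket_tangent x y).

(** ** Subgroups *)

Definition subgroup_set (N : set G) :=
  [/\ N 1%g, forall g h, N g -> N h -> N (g * h)%g & forall g, N g -> N (g^-1)%g].

Definition closed_subgroup (N : set G) :=
  subgroup_set N /\ closed (N : set (zariski G)).

Definition simple_alg_group :=
  [/\ connected [set: zariski G],
      exists g h : G, (g * h)%g <> (h * g)%g &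
      forall N : set G, closed_subgroup N -> connected (N : set (zariski G)) ->
        (forall g h, N h -> N (g^-1 * h * g)%g) -> N = [set 1%g] \/ N = setT].

(* right translation by u minus the identity is locally nilpotent on O(G) *)
Definition unipotent (u : G) := forall f, reg f -> exists n : nat,
  iter n (fun (k : G -> K) h => k (h * u)%g - k h) f = 0.

Definition unipotent_subgroup (N : set G) :=
  [/\ closed_subgroup N, connected (N : set (zariski G)) &
      forall u, N u -> unipotent u].

(* Lie(N) inside Lie(G): the tangent vectors killing the ideal of N *)
Definition lie_sub (N : set G) : set lie :=
  [set x | forall f, reg f -> (forall g, N g -> f g = 0) -> x f = 0].

Record lie_basis (N : set G) := LieBasis {
  lb_dim : nat;
  lb_vec : 'I_lb_dim -> lie;
  lb_str : 'I_lb_dim -> 'I_lb_dim -> 'I_lb_dim -> K;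
  lb_in : forall i, lie_sub N (lb_vec i);
  lb_free : forall k : 'I_lb_dim -> K,
    \sum_i k i *: lb_vec i = 0 -> forall i, k i = 0;
  lb_span : forall x, lie_sub N x ->
    exists k : 'I_lb_dim -> K, x = \sum_i k i *: lb_vec i;
  lb_bracket : forall i j,
    lie_bracket (lb_vec i) (lb_vec j) = \sum_p lb_str i j p *: lb_vec p
}.

(** ** Homogeneous space *)

Definition cosets (N : set G) : Type :=
  {S : set G | exists g : G, S = [set (g * n)%g | n in N]}.

Definition coset_proj (N : set G) (g : zariski G) : cosets N :=
  exist _ [set (g * n)%g | n in N] (ex_intro _ g erefl).
Arguments coset_proj : clear implicits.

(* The quotient topology is the Zariski topology of the variety G/N. *)
Definition coset_open (N : set G) (U : set (cosets N)) :=
  open (coset_proj N @^-1` U).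

HB.instance Definition _ N := gen_eqMixin (cosets N).
HB.instance Definition _ N := gen_choiceMixin (cosets N).

Fact coset_openT N : @coset_open N setT. Proof. exact: openT. Qed.

Fact coset_openI N (U V : set (cosets N)) :
  coset_open U -> coset_open V -> coset_open (U `&` V).
Proof. exact: openI. Qed.

Fact coset_open_bigU N (I : Type) (F : I -> set (cosets N)) :
  (forall i, coset_open (F i)) -> coset_open (\bigcup_i F i).
Proof.
move=> oF; rewrite /coset_open preimage_bigcup.
by apply: bigcup_open => i _; exact: oF.
Qed.

HB.instance Definition _ N := isOpenTopological.Build (cosets N)
  (@coset_openT N) (@coset_openI N) (@coset_open_bigU N).

Definition coset_pre (N : set G) (U : opens (cosets N)) : opens (zariski G) :=
  @Opens (zariski G) (coset_proj N @^-1` U) (oset_open U).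
End Group.

Arguments lie {K} G.
Arguments lie_bracket {K G}.
Arguments lb_vec {K G N} l i.
Arguments lb_str {K G N} l i j p.

(** * Invariant forms *)

Section Forms.
Variables (K : numClosedFieldType) (L : lmodType K) (br : L -> L -> L).

(* The trace of an endomorphism of a finite dimensional space, computed in some
   basis. *)
Definition has_trace (u : L -> L) (t : K) :=
  exists (n : nat) (e : 'I_n -> L) (M : 'M[K]_n),
    [/\ forall v, exists! k : 'rV[K]_n, v = \sum_i k 0 i *: e i,
        forall j, u (e j) = \sum_i M i j *: e i & t = \tr M].

Definition lin_trace (u : L -> L) : K := xget 0 [set t | has_trace u t].

Definition killing (x y : L) : K := lin_trace (fun z => br x (br y z)).

Definition dual_level (B : L -> L -> K) : L -> L -> K :=
  fun x y => - killing x y - B x y.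

Definition invariant_form (B : L -> L -> K) :=
  [/\ forall c x y z, B (c *: x + y) z = c * B x z + B y z,
      forall x y, B x y = B y x &
      forall x y z, B (br x y) z = B x (br y z)].
End Forms.

(** * Graded vertex superalgebras *)

Definition binz (K : numClosedFieldType) (m : int) (j : nat) : K :=
  (\prod_(i < j) (m - i%:Z)%:~R) / (j`!)%:R.

Section GradedVertexSuperalgebras.
Variable K : numClosedFieldType.

(* [vhom i p] is the space of elements of weight i and parity p (true = odd). *)
Record gvsa := Gvsa {
  vsort :> lmodType K;
  vac : vsort;
  vder : vsort -> vsort;
  vprod : int -> vsort -> vsort -> vsort;
  vhom : nat -> bool -> set vsort;
  vder_lin : forall c x y, vder (c *: x + y) = c *: vder x + vder y;
  vprod_linl : forall n c x y z,
    vprod n (c *: x + y) z = c *: vprod n x z + vprod n y z;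
  vprod_linr : forall n c x y z,
    vprod n x (c *: y + z) = c *: vprod n x y + vprod n x z;
  vhom0 : forall i p, vhom i p 0;
  vhom_lin : forall i p c x y,
    vhom i p x -> vhom i p y -> vhom i p (c *: x + y);
  vhom_span : forall x, exists (n : nat) (u : nat -> bool -> vsort),
    (forall i p, vhom i p (u i p)) /\ x = \sum_(i < n) (u i false + u i true);
  vhom_direct : forall (n : nat) (u : nat -> bool -> vsort),
    (forall i p, vhom i p (u i p)) ->
    \sum_(i < n) (u i false + u i true) = 0 ->
    forall i p, (i < n)%N -> u i p = 0;
  vhom_vac : vhom 0 false vac;
  vhom_der : forall i p x, vhom i p x -> vhom i.+1 p (vder x);
  vhom_prod : forall i j p q x y (n : int) (k : nat),
    vhom i p x -> vhom j q y -> k%:Z = i%:Z + j%:Z - n - 1 ->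
    vhom k (p (+) q) (vprod n x y);
  vhom_prod0 : forall i j p q x y (n : int),
    vhom i p x -> vhom j q y -> i%:Z + j%:Z - n - 1 < 0 -> vprod n x y = 0;
  vac_prod : forall n x, vprod n vac x = if n == -1 then x else 0;
  vprod_vac : forall x, vprod (-1) x vac = x;
  vprod_vac0 : forall n x, 0 <= n -> vprod n x vac = 0;
  vder_vac : forall x, vder x = vprod (-2) x vac;
  (* Borcherds identity; both sums are finite, truncated at any bound N beyond
     which every summand vanishes. *)
  borcherds : forall i j p q x y z (m n k : int) (N : nat),
    vhom i p x -> vhom j q y ->
    (forall l : nat, (N <= l)%N ->
      [/\ vprod (n + l%:Z) x y = 0, vprod (k + l%:Z) y z = 0 &
          vprod (m + l%:Z) x z = 0]) ->
    \sum_(l < N) binz K m l *: vprod (m + k - l%:Z) (vprod (n + l%:Z) x y) z =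
    \sum_(l < N) ((-1) ^+ l * binz K n l) *:
      (vprod (m + n - l%:Z) x (vprod (k + l%:Z) y z) -
       ((-1) ^ n * (-1) ^+ (p && q)) *:
       vprod (n + k - l%:Z) y (vprod (m + l%:Z) x z))
}.

Definition is_even (V : gvsa) := forall i (x : V), vhom i true x -> x = 0.

Definition vmorph (V W : gvsa) (f : V -> W) :=
  [/\ forall c x y, f (c *: x + y) = c *: f x + f y,
      f (vac V) = vac W &
      forall n x y, f (vprod n x y) = vprod n (f x) (f y)].

Definition graded_vmorph (V W : gvsa) (f : V -> W) :=
  vmorph f /\ forall i p x, vhom i p x -> vhom i p (f x).

Definition vgenerated (V : gvsa) (S : set V) :=
  forall P : set V, S `<=` P -> P (vac V) ->
    (forall c x y, P x -> P y -> P (c *: x + y)) ->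
    (forall n x y, P x -> P y -> P (vprod n x y)) ->
    forall x, P x.

(* V is generated by the family gen of elements indexed by X, subject only to
   the relations rel. *)
Definition presented (X : Type) (rel : forall W : gvsa, (X -> W) -> Prop)
    (V : gvsa) (gen : X -> V) :=
  [/\ rel V gen, vgenerated (range gen) &
      forall (W : gvsa) (gen' : X -> W), rel W gen' ->
        exists f : V -> W, graded_vmorph f /\ forall x, f (gen x) = gen' x].

(** ** Universal affine vertex algebra *)

Section Affine.
Variables (L : lmodType K) (br : L -> L -> L) (B : L -> L -> K).

Definition affine_rel (W : gvsa) (tau : L -> W) :=
  [/\ is_even W,
      forall c x y, tau (c *: x + y) = c *: tau x + tau y,
      forall x, vhom 1 false (tau x),
      forall x y, vprod 1 (tau x) (tau y) = B x y *: vac W &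
      (forall x y, vprod 0 (tau x) (tau y) = tau (br x y)) /\
      (forall x y (n : int), 2 <= n -> vprod n (tau x) (tau y) = 0)].

Record affine_va := AffineVA {
  aff_va :> gvsa;
  aff_gen : L -> aff_va;
  aff_presented : presented affine_rel aff_gen
}.
End Affine.

(** ** Charged free fermions *)

Section Ghosts.
Variable r : nat.

(* The generator [inl i] is phi_i and [inr i] is phi_i^*. *)
Definition ghost_rel (W : gvsa) (phi : 'I_r + 'I_r -> W) :=
  [/\ forall i, vhom 1 true (phi (inl i)) /\ vhom 0 true (phi (inr i)),
      forall i j (n : int), 0 <= n -> vprod n (phi (inl i)) (phi (inl j)) = 0,
      forall i j (n : int), 0 <= n -> vprod n (phi (inr i)) (phi (inr j)) = 0 &
      forall i j (n : int), 0 <= n ->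
        vprod n (phi (inl i)) (phi (inr j)) =
        if (i == j) && (n == 0) then vac W else 0].

Record ghosts := Ghosts {
  gh_va :> gvsa;
  gh_gen : 'I_r + 'I_r -> gh_va;
  gh_presented : presented ghost_rel gh_gen
}.

Inductive ghost_charge (F : ghosts) : int -> F -> Prop :=
| charge_vac : ghost_charge 0 (vac F)
| charge_phi i : ghost_charge (-1) (gh_gen F (inl i))
| charge_phi_star i : ghost_charge 1 (gh_gen F (inr i))
| charge_zero p : ghost_charge p (0 : F)
| charge_lin p c (x y : F) :
    ghost_charge p x -> ghost_charge p y -> ghost_charge p (c *: x + y)
| charge_prod p q n (x y : F) :
    ghost_charge p x -> ghost_charge q y -> ghost_charge (p + q) (vprod n x y).
End Ghosts.

(** ** Tensor products *)

Definition bilin_map (A B W : lmodType K) (b : A -> B -> W) :=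
  (forall c x y z, b (c *: x + y) z = c *: b x z + b y z) /\
  (forall c x y z, b x (c *: y + z) = c *: b x y + b x z).

(* T with t is the tensor product of the spaces A and B, with
   (a (x) b)_(n) (a' (x) b') =
     (-1)^{|b||a'|} sum_{k in Z} a_(k) a' (x) b_(n-k-1) b';
   the sum is truncated to the k = N - 1 - l, l < M, outside of which every
   summand vanishes. *)
Definition tensor_product (A B T : gvsa) (t : A -> B -> T) :=
  [/\ bilin_map t,
      forall (W : lmodType K) (b : A -> B -> W), bilin_map b ->
        exists! f : T -> W, (forall c x y, f (c *: x + y) = c *: f x + f y) /\
          (forall x y, f (t x y) = b x y),
      t (vac A) (vac B) = vac T,
      forall i j p q x y, vhom i p x -> vhom j q y ->
        vhom (i + j)%N (p (+) q) (t x y) &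
      forall i j p q a b a' b' (n N : int) (M : nat),
        vhom j q b -> vhom i p a' ->
        (forall k, N <= k -> vprod k a a' = 0) ->
        (forall k, n - N + M%:Z <= k -> vprod k b b' = 0) ->
        vprod n (t a b) (t a' b') = (-1) ^+ (q && p) *:
          \sum_(l < M) t (vprod (N - 1 - l%:Z) a a') (vprod (n - N + l%:Z) b b')].
End GradedVertexSuperalgebras.

(** * Presheaves and sheaves of graded vertex superalgebras *)

Section Sheaves.
Variables (K : numClosedFieldType) (X : topologicalType).

Definition opensT : opens X := Opens openT.
Definition opensI (U V : opens X) : opens X :=
  Opens (openI (oset_open U) (oset_open V)).

(* Only the restrictions to smaller open sets are meaningful. *)
Record presheaf := Presheaf {
  sec :> opens X -> gvsa K;
  res : forall U V, sec U -> sec V;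
  res_morph : forall (U V : opens X), V `<=` U -> graded_vmorph (@res U V);
  res_id : forall U (s : sec U), res U s = s;
  res_comp : forall (U V W : opens X) (s : sec U), V `<=` U -> W `<=` V ->
    res W (res V s) = res W s
}.

Definition is_sheaf (F : presheaf) :=
  forall (U : opens X) (S : set (opens X)),
    (U : set X) = \bigcup_(V in S) V ->
    (forall s t : F U, (forall V, S V -> res V s = res V t) -> s = t) /\
    (forall s : (forall V, F V),
      (forall V W, S V -> S W ->
        res (opensI V W) (s V) = res (opensI V W) (s W)) ->
      exists t : F U, forall V, S V -> res V t = s V).
End Sheaves.

Arguments opensT {X}.
Arguments res {K X p U} V s.

(** * Chiral differential operators and BRST cohomology *)

Section CDO.
Variables (K : numClosedFieldType) (G : alg_group K).
Variable B : lie G -> lie G -> K.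

Section Relations.
Variable U : opens (zariski G).

Definition cdo_rel (W : gvsa K) (gen : regfun U + lie G -> W) :=
  let al (f : regfun U) := gen (inl f) in
  let tau (x : lie G) := gen (inr x) in
  [/\ [/\ forall c f h, al (c *: f + h) = c *: al f + al h,
          forall f, vhom 0 false (al f),
          al (regfun1 U) = vac W,
          forall f h, vprod (-1) (al f) (al h) = al (regfun_mul f h) &
          forall f h (n : int), 0 <= n -> vprod n (al f) (al h) = 0],
      (forall x f, vprod 0 (tau x) (al f) = al (vfL x f)) /\
      (forall x f (n : int), 1 <= n -> vprod n (tau x) (al f) = 0) &
      affine_rel lie_bracket B tau].
End Relations.

Record cdo := Cdo {
  cdo_sheaf :> presheaf K (zariski G);
  cdo_is_sheaf : is_sheaf cdo_sheaf;
  cdo_even : forall U, is_even (cdo_sheaf U);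
  (* meaningful for affine U only *)
  cdo_gen : forall U, regfun U + lie G -> cdo_sheaf U;
  cdo_presented : forall U, affine_open U ->
    presented (@cdo_rel U) (@cdo_gen U);
  cdo_res_fun : forall (U V : opens (zariski G)) (f : regfun U) (h : regfun V),
    affine_open U -> affine_open V -> V `<=` U ->
    (forall g, V g -> h g = f g) ->
    res V (cdo_gen (inl f)) = cdo_gen (inl h);
  cdo_res_lie : forall (U V : opens (zariski G)) (x : lie G),
    affine_open U -> affine_open V -> V `<=` U ->
    res V (@cdo_gen U (inr x)) = @cdo_gen V (inr x)
}.

Definition cdo_global (D : cdo) : gvsa K := D opensT.
Definition cdo_lie (D : cdo) (x : lie G) : cdo_global D := cdo_gen D (inr x).
Definition cdo_fun (D : cdo) (f : regfun opensT) : cdo_global D :=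
  cdo_gen D (inl f).

(* Under Theta + Omega^1 = (weight 1), (a i_L(x), b dc) |-> a_(-1) x + b_(-1) dc,
   the global section w of weight 1 projects to the vector field xi. *)
Definition projects_to (D : cdo) (w : cdo_global D)
    (xi : regfun (@opensT (zariski G)) -> G -> K) :=
  exists (n m : nat) (a : 'I_n -> regfun opensT) (x : 'I_n -> lie G)
    (b c : 'I_m -> regfun opensT),
  w = \sum_(i < n) vprod (-1) (cdo_fun D (a i)) (cdo_lie D (x i)) +
      \sum_(k < m) vprod (-1) (cdo_fun D (b k)) (vder (cdo_fun D (c k))) /\
  forall (f : regfun opensT) (g : G),
    xi f g = \sum_(i < n) a i g * lder (x i) f g.

Definition dual_embedding (D : cdo)
    (V : affine_va lie_bracket (dual_level lie_bracket B))
    (j : V -> cdo_global D) :=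
  [/\ vmorph j, injective j,
      forall x, vhom 1 false (j (aff_gen V x)),
      forall x, projects_to (j (aff_gen V x)) (fun f g => rder x f g) &
      forall x y (n : int), 0 <= n -> vprod n (cdo_lie D x) (j (aff_gen V y)) = 0].

Section BRST.
Variables (N : set G) (a : lie_basis N) (D : cdo) (F : ghosts K (lb_dim a)).

Record brst_complex := BrstComplex {
  brst_sheaf :> presheaf K (cosets N);
  brst_tens : forall U : opens (cosets N), F -> D (coset_pre U) -> brst_sheaf U;
  brst_tensP : forall U, tensor_product (@brst_tens U);
  brst_res : forall (U V : opens (cosets N)) c (s : D (coset_pre U)),
    V `<=` U ->
    res V (@brst_tens U c s) = @brst_tens V c (res (coset_pre V) s)
}.

Variable C : brst_complex.

(* The triple product phi_p phi_i^* phi_j^* is normally ordered from the right. *)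
Definition brst_D (U : opens (cosets N)) : C U :=
  let phi i := gh_gen F (inl i) in
  let phis i := gh_gen F (inr i) in
  \sum_i brst_tens C (phis i) (res (coset_pre U) (cdo_lie D (lb_vec a i))) -
  2^-1 *: \sum_i \sum_j \sum_p lb_str a i j p *:
    brst_tens C (vprod (-1) (phi p) (vprod (-1) (phis i) (phis j)))
      (vac (D (coset_pre U))).

Definition brst_d (U : opens (cosets N)) (t : C U) : C U :=
  vprod 0 (brst_D U) t.

Definition brst_charge (U : opens (cosets N)) (q : int) (t : C U) :=
  exists (n : nat) (c : 'I_n -> F) (s : 'I_n -> D (coset_pre U)),
    (forall i, ghost_charge q (c i)) /\ t = \sum_(i < n) brst_tens C (c i) (s i).

Definition brst_cocycle (U : opens (cosets N)) (q : int) (t : C U) :=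
  brst_charge q t /\ brst_d t = 0.

Definition brst_local_coboundary (U : opens (cosets N)) (q : int) (t : C U) :=
  forall x, U x -> exists V : opens (cosets N),
    [/\ V x, V `<=` U &
        exists t' : C V, brst_charge (q - 1) t' /\ brst_d t' = res V t].

(* The sheaf of graded vertex algebras H^0: the quotient of the sheaf of cocycles
   of charge 0 by the image sheaf of d, with the operations induced from C. The
   class map [h0_cl] is meaningful on cocycles of charge 0 only. *)
Record brst_H0 := BrstH0 {
  h0_sheaf :> presheaf K (cosets N);
  h0_is_sheaf : is_sheaf h0_sheaf;
  h0_even : forall U, is_even (h0_sheaf U);
  h0_cl : forall U, C U -> h0_sheaf U;
  h0_lin : forall U k (s t : C U), brst_cocycle 0 s -> brst_cocycle 0 t ->
    @h0_cl U (k *: s + t) = k *: @h0_cl U s + @h0_cl U t;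
  h0_vac : forall U, @h0_cl U (vac (C U)) = vac (h0_sheaf U);
  h0_prod : forall U n (s t : C U), brst_cocycle 0 s -> brst_cocycle 0 t ->
    @h0_cl U (vprod n s t) = vprod n (@h0_cl U s) (@h0_cl U t);
  h0_hom : forall U i p (t : C U), brst_cocycle 0 t -> vhom i p t ->
    vhom i p (@h0_cl U t);
  h0_res : forall (U V : opens (cosets N)) (t : C U), V `<=` U ->
    brst_cocycle 0 t -> res V (@h0_cl U t) = @h0_cl V (res V t);
  h0_ker : forall U (t : C U), brst_cocycle 0 t ->
    (@h0_cl U t = 0 <-> brst_local_coboundary 0 t);
  h0_surj : forall (U : opens (cosets N)) (h : h0_sheaf U) x, U x ->
    exists V : opens (cosets N), [/\ V x, V `<=` U &
      exists t : C V, brst_cocycle 0 t /\ @h0_cl V t = res V h]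
}.

Definition one_tens (s : cdo_global D) : C opensT :=
  brst_tens C (vac F) (res (coset_pre opensT) s).
End BRST.
End CDO.

(* Main.v *)
Require Import Defs.
From mathcomp Require Import all_boot all_order all_algebra.
From mathcomp Require Import all_classical all_reals complex.
From mathcomp Require Import zify.

(** The generators [a_i] of [g] have trivial OPE with the generators of the image
    of [j_R], hence, by the commutator formula, with the whole image.  So [D_(0)]
    kills [1 (x) j_R(v)], and [b |-> 1 (x) b] respects all products. *)

Set Implicit Arguments.
Unset Strict Implicit.
Unset Printing Implicit Defensive.

Import Order.TTheory GRing.Theory Num.Theory.
Local Open Scope ring_scope.

Section GradedVertexSuperalgebras.
Variable K : numClosedFieldType.
Implicit Types V A T W : gvsa K.

Lemma vprodDl V n (x y z : V) :
  vprod n (x + y) z = vprod n x z + vprod n y z.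
Proof. by rewrite -{1}[x]scale1r vprod_linl scale1r. Qed.

Lemma vprodDr V n (x y z : V) :
  vprod n x (y + z) = vprod n x y + vprod n x z.
Proof. by rewrite -{1}[y]scale1r vprod_linr scale1r. Qed.

Lemma vprod0l V n (z : V) : vprod n 0 z = 0.
Proof. by apply: (@addrI _ (vprod n 0 z)); rewrite -vprodDl !addr0. Qed.

Lemma vprod0r V n (z : V) : vprod n z 0 = 0.
Proof. by apply: (@addrI _ (vprod n z 0)); rewrite -vprodDr !addr0. Qed.

Lemma vprodZl V n c (x z : V) : vprod n (c *: x) z = c *: vprod n x z.
Proof. by rewrite -[c *: x]addr0 vprod_linl vprod0l addr0. Qed.

Lemma vprod_suml V n I (r : seq I) (u : I -> V) (z : V) :
  vprod n (\sum_(i <- r) u i) z = \sum_(i <- r) vprod n (u i) z.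
Proof.
by apply: (big_morph (fun x => vprod n x z)) => [x y|];
  rewrite ?vprodDl ?vprod0l.
Qed.

(** The truncation, Borcherds and tensor axioms speak of homogeneous elements; this carries any
    additive consequence of them to all elements. *)
Lemma vhom_ind V (P : V -> Prop) :
  (forall x y, P x -> P y -> P (x + y)) ->
  (forall i p x, vhom i p x -> P x) -> forall x, P x.
Proof.
move=> PD Ph x; have [n [u [hu ->]]] := vhom_span x.
apply: big_ind => [||i _]; first exact: (Ph 0%N false _ (vhom0 _ _ _)).
  exact: PD.
by apply: PD; apply: Ph (hu _ _).
Qed.

Lemma even_vhom_ind V (P : V -> Prop) : is_even V ->
  (forall x y, P x -> P y -> P (x + y)) ->
  (forall i x, vhom i false x -> P x) -> forall x, P x.
Proof.
move=> ev PD Ph; apply: vhom_ind => // i [] x hx; last exact: (Ph i).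
by rewrite (ev _ _ hx); apply: (Ph 0%N); exact: vhom0.
Qed.

Lemma vprod_locality V (x y : V) :
  exists N : nat, forall k : int, N%:Z <= k -> vprod k x y = 0.
Proof.
elim/vhom_ind: x => [x x' [N hN] [N' hN']|i p x hx].
  by exists (maxn N N') => k hk; rewrite vprodDl hN ?hN' ?addr0 //; lia.
elim/vhom_ind: y => [y y' [N hN] [N' hN']|j q y hy].
  by exists (maxn N N') => k hk; rewrite vprodDr hN ?hN' ?addr0 //; lia.
(* From index [i + j] on, the product would have negative weight. *)
by exists (i + j)%N => k hk; apply: (vhom_prod0 hx hy); lia.
Qed.

Lemma binz00 l : binz K 0 l = (l == 0%N)%:R.
Proof.
rewrite /binz; case: l => [|l]; first by rewrite big_ord0 fact0 divr1.
by rewrite big_ord_recl subrr mulr0z mul0r mul0r.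
Qed.

(* The truncation is only asked to be large enough, which makes the statement
   additive in [x] and [y]: Borcherds' identity holds for homogeneous [x], [y]. *)
Lemma commutator_formula V (x y z : V) (m k : int) : is_even V ->
  exists N0 : nat, forall N, (N0 <= N)%N ->
    \sum_(l < N) binz K m l *: vprod (m + k - l%:Z) (vprod l%:Z x y) z =
    vprod m x (vprod k y z) - vprod k y (vprod m x z).
Proof.
move=> ev.
move: x; apply: (even_vhom_ind ev) => [x x' [N hN] [N' hN']|i x hx].
  exists (maxn N N') => M; rewrite geq_max => /andP[/hN e /hN' e'].
  rewrite !(vprodDl, vprodDr) opprD addrACA -e -e' -big_split /=.
  by apply: eq_bigr => l _; rewrite !vprodDl scalerDr.
move: y; apply: (even_vhom_ind ev) => [y y' [N hN] [N' hN']|j y hy].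
  exists (maxn N N') => M; rewrite geq_max => /andP[/hN e /hN' e'].
  rewrite !(vprodDl, vprodDr) opprD addrACA -e -e' -big_split /=.
  by apply: eq_bigr => l _; rewrite !(vprodDl, vprodDr) scalerDr.
have [N1 h1] := vprod_locality x y.
have [N2 h2] := vprod_locality y z.
have [N3 h3] := vprod_locality x z.
(* The absolute values absorb the shifts by [k] and [m]; the successor ensures that the term [l = 0]
   is in the sum. *)
exists (N1 + (N2 + `|k|) + (N3 + `|m|)).+1%N => N hN.
(* At [n = 0] the coefficient [binz K 0 l] kills every term on the right but [l = 0], which is the
   commutator. *)
have := @borcherds K V i j false false x y z m 0 k N hx hy.
under eq_bigr do rewrite add0r.
move=> -> => [|l hl]; last by split; [apply: h1|apply: h2|apply: h3]; lia.
case: N hN => // N _; rewrite big_ord_recl big1 ?addr0 => [|l _].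
  by rewrite binz00 expr0 !mulr1 !scale1r add0r.
by rewrite binz00 mulr0 scale0r.
Qed.

(** The left side of the commutator formula vanishes, so the modes [m] of [x] and [k] of [y]
    commute. *)
Lemma vprod_annihilates V (x y z : V) (m k : int) : is_even V ->
  (forall l : nat, vprod l%:Z x y = 0) -> vprod m x z = 0 ->
  vprod m x (vprod k y z) = 0.
Proof.
move=> ev xy xz; have [N /(_ N (leqnn N))] := commutator_formula x y z m k ev.
rewrite xz vprod0r subr0 => <-; rewrite big1 // => l _.
by rewrite xy vprod0l scaler0.
Qed.

Section TensorProduct.
Variables (A W T : gvsa K) (t : A -> W -> T).
Hypothesis tP : tensor_product t.

Lemma tensorDr x y z : t x (y + z) = t x y + t x z.
Proof.
have [[_ tr] _ _ _ _] := tP.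
by rewrite -{1}[y]scale1r tr scale1r.
Qed.

Lemma tensor0r x : t x 0 = 0.
Proof. by apply: (@addrI _ (t x 0)); rewrite -tensorDr !addr0. Qed.

Lemma tensor0l y : t 0 y = 0.
Proof.
have [[tl _] _ _ _ _] := tP.
by have := tl (-1) 0 0 y; rewrite scaler0 addr0 scaleN1r addNr.
Qed.

(** Since nonnegative products with the vacuum vanish, the tensor formula can be cut at [N = 0]. The
    vacuum is even and homogeneous, so there is no sign and only [b] has to be decomposed. *)
Lemma vprod_tensor_vac (x : A) (b b' : W) (n : int) :
  exists M0 : nat, forall M, (M0 <= M)%N ->
    vprod n (t x b) (t (vac A) b') =
    \sum_(l < M) t (vprod (- 1 - l%:Z) x (vac A)) (vprod (n + l%:Z) b b').
Proof.
elim/vhom_ind: b => [b1 b2 [N hN] [N' hN']|j q b hb].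
  exists (maxn N N') => M; rewrite geq_max => /andP[/hN e /hN' e'].
  rewrite tensorDr vprodDl e e' -big_split /=.
  by apply: eq_bigr => l _; rewrite vprodDl tensorDr.
have [N hN] := vprod_locality b b'.
exists (N + `|n|)%N => M hM.
have [_ _ _ _ h] := tP.
rewrite (h _ _ _ _ _ _ _ _ n 0 M hb (vhom_vac A)) => [||k hk].
- by rewrite andbF expr0 scale1r; apply: eq_bigr => l _; rewrite sub0r subr0.
- by move=> k; apply: vprod_vac0.
- by apply: hN; lia.
Qed.

(** At [n = 0] the second factors are exactly the nonnegative products of [b] with [b']. *)
Lemma vprod0_tensor_vac (x : A) (b b' : W) :
  (forall l : nat, vprod l%:Z b b' = 0) ->
  vprod 0 (t x b) (t (vac A) b') = 0.
Proof.
move=> bb'; have [M /(_ M (leqnn M)) ->] := vprod_tensor_vac x b b' 0.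
by rewrite big1 // => l _; rewrite add0r bb' tensor0r.
Qed.

Lemma vac_tensor_vmorph : vmorph (t (vac A)).
Proof.
have [[_ tr] _ tv _ _] := tP; split => // n b b'.
(* A nonempty range is needed: only [l = 0] survives, as the vacuum acts nontrivially in mode -1
   alone. *)
have [M /(_ M.+1 (leqnSn M)) ->] := vprod_tensor_vac (vac A) b b' n.
rewrite big_ord_recl big1 ?addr0 => [|l _].
  by rewrite vprod_vac.
by rewrite lift0 vac_prod; case: eqP => [?|_]; [lia|exact: tensor0l].
Qed.
End TensorProduct.

Lemma vmorph0 V W (f : V -> W) : vmorph f -> f 0 = 0.
Proof.
move=> [fl _ _]; have := fl (-1) 0 0.
by rewrite scaler0 addr0 scaleN1r addNr.
Qed.

Lemma vmorph_comp V A W (f : A -> W) (g : V -> A) :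
  vmorph f -> vmorph g -> vmorph (f \o g).
Proof.
move=> [fl fv fp] [gl gv gp]; split=> [c x y||n x y] /=.
- by rewrite gl fl.
- by rewrite gv fv.
- by rewrite gp fp.
Qed.

End GradedVertexSuperalgebras.

Section DualEmbedding.
Variables (K : numClosedFieldType) (G : alg_group K) (B : lie G -> lie G -> K).
Variables (D : cdo B) (V : affine_va lie_bracket (dual_level lie_bracket B)).
Variable j : V -> cdo_global D.
Hypothesis jP : dual_embedding j.

Lemma lie_vprod_dual_embedding x v (n : int) : 0 <= n ->
  vprod n (cdo_lie D x) (j v) = 0.
Proof.
have [[jl jv jp] _ _ _ jg] := jP; have [_ gen _] := aff_presented V.
move: v n; apply: gen => [_ [y _ <-] n|n|c u v hu hv n|m u v hu hv n] n0.
(* [n] is quantified inside the induction: the product case needs every nonnegative mode on the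
   first factor. *)
- exact: jg.
- by rewrite jv vprod_vac0.
- by rewrite jl vprod_linr hu // hv // scaler0 addr0.
- rewrite jp; apply: vprod_annihilates; first exact: cdo_even.
    by move=> l; exact: hu.
  exact: hv.
Qed.

Section BRST.
Variables (N : set G) (a : lie_basis N) (F : ghosts K (lb_dim a)).
Variable C : brst_complex D F.

(** [coset_pre opensT] has the same points as [opensT] but is a different term, so global sections
    reach it through [res]. *)
Lemma res_coset_preT :
  vmorph (res (coset_pre (N := N) opensT) : cdo_global D -> _).
Proof.
by have [] := @res_morph _ _ D opensT (coset_pre (N := N) opensT) (fun _ _ => I).
Qed.

Lemma one_tens_vmorph : vmorph (one_tens C).
Proof.
apply: (vmorph_comp (vac_tensor_vmorph (brst_tensP C opensT))).
exact: res_coset_preT.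
Qed.

Lemma dual_embedding_cocycle v : brst_cocycle 0 (one_tens C (j v)).
Proof.
split.
  exists 1%N, (fun=> vac F), (fun=> res (coset_pre opensT) (j v)).
  by split=> [_|]; [exact: charge_vac|rewrite big_ord1].
have tP := brst_tensP C opensT.
have rm := res_coset_preT.
rewrite /brst_d /brst_D vprodDl -scaleNr vprodZl !vprod_suml !big1.
- by rewrite scaler0 addr0.
(* The cubic ghost terms have the vacuum as second factor, whose nonnegative modes are zero. *)
- move=> i _; rewrite vprod_suml big1 // => k _; rewrite vprod_suml big1 // => p _.
  rewrite vprodZl (vprod0_tensor_vac tP) ?scaler0 // => l.
  by rewrite vac_prod.
(* For the terms linear in the ghosts, the trivial OPE with the image of [j] survives
   restriction. *)
- move=> i _; apply: (vprod0_tensor_vac tP) => l.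
  have [_ _ rp] := rm.
  by rewrite -rp lie_vprod_dual_embedding // (vmorph0 rm).
Qed.
End BRST.
End DualEmbedding.

Theorem corollary4p8 (R : realType) (G : alg_group R[i]%C)
  (hG : simple_alg_group G)
  (N : set G) (hN : unipotent_subgroup N)
  (B : lie G -> lie G -> R[i]%C) (hB : invariant_form lie_bracket B)
  (D : cdo B)
  (V : affine_va lie_bracket (dual_level lie_bracket B))
  (jR : V -> cdo_global D) (hjR : dual_embedding jR)
  (a : lie_basis N) (F : ghosts R[i]%C (lb_dim a))
  (C : brst_complex D F) (H : brst_H0 C) :
  (forall v : V, brst_cocycle 0%R (one_tens C (jR v))) /\
  vmorph (fun v : V => h0_cl H (one_tens C (jR v)) : h0_sheaf H opensT).
Proof.
have Z v := dual_embedding_cocycle hjR C v.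
have [jm _ _ _ _] := hjR.
have [ml mv mp] := vmorph_comp (one_tens_vmorph C) jm.
rewrite /= in ml mv mp.
(* The class map respects sums and products of cocycles only; [Z] supplies this condition. *)
split=> //; split=> [c x y||n x y].
- by rewrite ml h0_lin.
- by rewrite mv h0_vac.
- by rewrite mp h0_prod.
Qed.
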